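(* Let $n<m$ (so $l=n$). Suppose Condition 1 and Condition 2 of the context hold and $f:\Omega\subset\mathbb{R}^N\to E_2$ is a sufficiently smooth function. Then any solution $u$ of the equation $$L_0\Bigl(\frac{\partial}{\partial x}\Bigr)Bu+\sum_{i=1}^q L_i\Bigl(\frac{\partial}{\partial x}\Bigr)A_iu=f(x)$$ can be represented in the form $$u(x)=B^+v(x)+(C(x),\Phi),$$ where $v(x)\in E_{2\infty-k}\cap E_{2\infty-(m-n)}$ is a solution of the regular equation $$\Bigl[L_0\Bigl(\frac{\partial}{\partial x}\Bigr)+\sum_{i=1}^qL_i\Bigl(\frac{\partial}{\partial x}\Bigr)A_iB^+\Bigr]v=(I-Q_k)f(x),$$ and the vector function $C(x)\in\mathbb{R}^k$ is defined from the system $$L_0\Bigl(\frac{\partial}{\partial x}\Bigr)\mathcal{A}_BC+\sum_{i=1}^qL_i\Bigl(\frac{\partial}{\partial x}\Bigr)\mathcal{A}_i'C=\langle f(x),\Psi\rangle .$$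
   Context: Setting. $E_1,E_2$ are real Banach spaces; $B,A_1,\dots,A_q$ are closed linear operators from $E_1$ to $E_2$ with dense domains, $D(B)\subseteq D(A_i)$. $B$ is Noetherian: its range is closed, $\dim N(B)=n<\infty$, $\dim N(B^* )=m<\infty$. Put $l=\min(m,n)$. For $i=0,\dots,q$, $L_i(\partial/\partial x)=\sum_{|\kappa|\le q_i}a^i_\kappa(x)D^\kappa$ is a scalar linear partial differential operator of order $q_i$, $q_0>q_1>\dots>q_q$, with sufficiently smooth coefficients $a^i_\kappa:\Omega\to\mathbb{R}$, $\Omega\subset\mathbb{R}^N$. Solutions are classical: $u$ takes values in $D(B)$ and $u$, $Bu$ are sufficiently smooth. An equation with leading term $L_0(\partial/\partial x)Tu$ is called regular if $T$ has a bounded inverse (here $T=I$). Condition 1 (complete Jordan sets). There are a basis $\varphi_1,\dots,\varphi_n$ of $N(B)$, a basis $\psi_1,\dots,\psi_m$ of $N(B^* )$, positive integers $p_1,\dots,p_l$, and elements $\varphi_i^{(j)}\in D(B)$, $\psi_i^{(j)}\in D(B^* )\cap D(A_1^* )$ ($i=1,\dots,l$, $j=1,\dots,p_i$) with $\varphi_i^{(1)}=\varphi_i$, $\psi_i^{(1)}=\psi_i$, $B\varphi_i^{(j+1)}=A_1\varphi_i^{(j)}$, $B^*\psi_i^{(j+1)}=A_1^*\psi_i^{(j)}$ for $1\le j\le p_i-1$, such that with $$\gamma_i^{(j)}=A_1^*\psi_i^{(p_i+1-j)},\qquad z_i^{(j)}=A_1\varphi_i^{(p_i+1-j)}$$ one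 has the biorthogonality relations $\langle\varphi_i^{(j)},\gamma_s^{(t)}\rangle=\delta_{is}\delta_{jt}$ and $\langle z_i^{(j)},\psi_s^{(t)}\rangle=\delta_{is}\delta_{jt}$. When $m>n$, moreover $\langle z_i^{(j)},\psi_s\rangle=0$ for $i\le n$, $s=n+1,\dots,m$, and $z_{n+1},\dots,z_m\in E_2$ are elements with $\langle z_i,\psi_s\rangle=\delta_{is}$ ($i,s=n+1,\dots,m$) and $\langle z_i,\psi_s^{(t)}\rangle=0$ for $i>n$, $s\le n$. Projectors. With $k=p_1+\dots+p_l$, $$P_k=\sum_{i=1}^l\sum_{j=1}^{p_i}\langle\cdot,\gamma_i^{(j)}\rangle\varphi_i^{(j)},\qquad Q_k=\sum_{i=1}^l\sum_{j=1}^{p_i}\langle\cdot,\psi_i^{(j)}\rangle z_i^{(j)},\qquad Q_{m-n}=\sum_{i=n+1}^m\langle\cdot,\psi_i\rangle z_i,$$ $E_{2\infty-k}=(I-Q_k)E_2$, $E_{2\infty-(m-n)}=(I-Q_{m-n})E_2$. $(P_k,Q_k)$-commutability. A closed densely defined operator $A:E_1\to E_2$ $(P_k,Q_k)$-commutes if for every $u\in D(A)$ one has $P_ku\in D(A)$ and $AP_ku=Q_kAu$. Condition 2. The operators $A_2,\dots,A_q$ $(P_k,Q_k)$-commute. ($B$ and $A_1$ do so under Condition 1.) Notation. $\Phi$, $\Psi$, $Z$ are the $k$-tuples of all $\varphi_i^{(j)}$, $\psi_i^{(j)}$, $z_i^{(j)}$ ($i\le l$, $j\le p_i$), in the same order.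 For $C=(C_{ij})\in\mathbb{R}^k$, $(C,\Phi)=\sum_{i=1}^l\sum_{j=1}^{p_i}C_{ij}\varphi_i^{(j)}$. For $y\in E_2$, $\langle y,\Psi\rangle\in\mathbb{R}^k$ is the vector of all $\langle y,\psi_i^{(j)}\rangle$. The $k\times k$ matrices $\mathcal{A}_i$ ($i=1,\dots,q$) are defined by $A_i\Phi=\mathcal{A}_iZ$, prime denotes transpose, so that $\langle A_i(C,\Phi),\Psi\rangle=\mathcal{A}_i'C$; $\mathcal{A}_B$ is the symmetric $k\times k$ matrix with $B\Phi=\mathcal{A}_BZ$, so that $\langle B(C,\Phi),\Psi\rangle=\mathcal{A}_BC$. Pseudoinverse (for $m>n$). $B^+:E_2\to E_1$ is the bounded pseudoinverse of $B$ determined by $B^+z_i^{(1)}=0$ ($i\le n$), $B^+z_i=0$ ($n<i\le m$) and, for $y\in R(B)$, $B^+y$ is the unique $w\in D(B)$ with $Bw=y$ and $\langle w,\gamma_i^{(1)}\rangle=0$ ($i=1,\dots,n$). *)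

(* Defs.v *)
From HB Require Import structures.
From mathcomp Require Import all_boot all_order all_algebra.
From mathcomp Require Import all_classical all_reals all_analysis.

Set Implicit Arguments.
Unset Strict Implicit.
Unset Printing Implicit Defensive.

Import Order.TTheory GRing.Theory Num.Theory.
Import numFieldNormedType.Exports.

Local Open Scope classical_set_scope.
Local Open Scope ring_scope.

(** All families indexed by natural numbers below follow the 1-based
    conventions of the Jordan chain literature: only the values at indices in
    the stated ranges are constrained or used. *)

(** * Unbounded linear operators *)

(* [op_fun] is total, but its values outside [dom] carry no information. *)
Record linop (R : realType) (E F : normedModType R) := Linop {
  dom : set E;
  op_fun :> E -> F;
  dom_zero : dom 0;
  dom_lin : forall a x y, dom x -> dom y -> dom (a *: x + y);
  op_lin : forall a x y, dom x -> dom y ->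
    op_fun (a *: x + y) = a *: op_fun x + op_fun y }.

Definition closed_op (R : realType) (E F : normedModType R)
    (T : linop E F) : Prop :=
  closed [set z : E * F | dom T z.1 /\ z.2 = T z.1].

Definition kernel (R : realType) (E F : normedModType R)
    (T : linop E F) : set E :=
  [set u | dom T u /\ T u = 0].

Definition oprange (R : realType) (E F : normedModType R)
    (T : linop E F) : set F :=
  [set T u | u in dom T].

Lemma total_op_subproof (R : realType) (E F : normedModType R)
    (f : {linear E -> F}) (a : R) (x y : E) :
  setT x -> setT y -> f (a *: x + y) = a *: f x + f y.
Proof. by move=> _ _; rewrite linearP. Qed.

Definition total_op (R : realType) (E F : normedModType R)
    (f : {linear E -> F}) : linop E F :=
  @Linop R E F setT f I (fun _ _ _ _ _ => I) (@total_op_subproof R E F f).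

Section CompOp.
Context (R : realType) (E F G : normedModType R).
Variables (T : linop F G) (f : {linear E -> F}).

Let cdom : set E := [set y | dom T (f y)].

Lemma comp_op_zero : cdom 0.
Proof. by rewrite /cdom /= linear0; exact: dom_zero. Qed.

Lemma comp_op_dom a x y : cdom x -> cdom y -> cdom (a *: x + y).
Proof. by rewrite /cdom /= linearP; exact: dom_lin. Qed.

Lemma comp_op_lin a x y : cdom x -> cdom y ->
  T (f (a *: x + y)) = a *: T (f x) + T (f y).
Proof. by rewrite linearP; exact: op_lin. Qed.

Definition comp_op : linop E G :=
  @Linop R E G cdom (T \o f) comp_op_zero comp_op_dom comp_op_lin.

End CompOp.

(** * Duals and adjoints *)

(* The pairing <x, psi> is written [psi x]. *)
Definition dual (R : realType) (E : normedModType R) : set (E -> R^o) :=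
  [set psi | linear psi /\ continuous psi].

Definition adjoint_spec (R : realType) (E F : normedModType R)
    (T : linop E F) (psi : F -> R^o) : set (E -> R^o) :=
  [set g | dual g /\ forall u, dom T u -> psi (T u) = g u].

Definition adjoint_dom (R : realType) (E F : normedModType R)
    (T : linop E F) : set (F -> R^o) :=
  [set psi | dual psi /\ adjoint_spec T psi !=set0].

(* When [dom T] is dense, [adjoint_spec T psi] has at most one element. *)
Definition adjoint (R : realType) (E F : normedModType R)
    (T : linop E F) (psi : F -> R^o) : E -> R^o :=
  xget 0 (adjoint_spec T psi).

Definition adjoint_kernel (R : realType) (E F : normedModType R)
    (T : linop E F) : set (F -> R^o) :=
  [set psi | adjoint_dom T psi /\ adjoint T psi = 0].

(** * Noetherian operators *)

(* [e 1], ..., [e d] is a basis of the linear subspace [S]. *)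
Definition is_basis (R : realType) (V : lmodType R) (S : set V) (d : nat)
    (e : nat -> V) : Prop :=
  (forall c : nat -> R, \sum_(1 <= i < d.+1) c i *: e i = 0 ->
     forall i, (1 <= i <= d)%N -> c i = 0) /\
  (forall v, S v <-> exists c : nat -> R, v = \sum_(1 <= i < d.+1) c i *: e i).

Definition noetherian (R : realType) (E F : normedModType R)
    (T : linop E F) (n m : nat) : Prop :=
  [/\ closed (oprange T),
      exists e, is_basis (kernel T) n e &
      exists e, is_basis (adjoint_kernel T) m e].

(** * Jordan chains *)

Section Jordan.
Context (R : realType) (E F : normedModType R).
Variables (B A1 : linop E F) (n m : nat) (p : nat -> nat).
Variables (phi : nat -> nat -> E) (psi : nat -> nat -> F -> R^o).

(* [phi i j] stands for phi_i^(j), [psi i j] for psi_i^(j); in particular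
   phi_i = [phi i 1] and psi_s = [psi s 1]. *)
Definition jgamma (i j : nat) : E -> R^o := adjoint A1 (psi i (p i + 1 - j)%N).
Definition jz (i j : nat) : F := A1 (phi i (p i + 1 - j)%N).

(* The case n < m, so that the number min(m, n) of chains is n.  [zeta i],
   for n < i <= m, are the additional elements z_i. *)
Record complete_jordan_sets (zeta : nat -> F) : Prop := CompleteJordanSets {
  cj_length : forall i, (1 <= i <= n)%N -> (0 < p i)%N;
  cj_basis : is_basis (kernel B) n (phi ^~ 1%N);
  cj_adj_basis : is_basis (adjoint_kernel B) m (psi ^~ 1%N);
  cj_dom : forall i j, (1 <= i <= n)%N -> (1 <= j <= p i)%N -> dom B (phi i j);
  cj_adj_dom : forall i j, (1 <= i <= n)%N -> (1 <= j <= p i)%N ->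
    adjoint_dom B (psi i j) /\ adjoint_dom A1 (psi i j);
  cj_chain : forall i j, (1 <= i <= n)%N -> (1 <= j < p i)%N ->
    B (phi i j.+1) = A1 (phi i j);
  cj_adj_chain : forall i j, (1 <= i <= n)%N -> (1 <= j < p i)%N ->
    adjoint B (psi i j.+1) = adjoint A1 (psi i j);
  cj_biorth_gamma : forall i j s t,
    (1 <= i <= n)%N -> (1 <= j <= p i)%N ->
    (1 <= s <= n)%N -> (1 <= t <= p s)%N ->
    jgamma s t (phi i j) = ((i == s) && (j == t))%:R;
  cj_biorth_z : forall i j s t,
    (1 <= i <= n)%N -> (1 <= j <= p i)%N ->
    (1 <= s <= n)%N -> (1 <= t <= p s)%N ->
    psi s t (jz i j) = ((i == s) && (j == t))%:R;
  cj_z_psi : forall i j s,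
    (1 <= i <= n)%N -> (1 <= j <= p i)%N -> (n < s <= m)%N ->
    psi s 1%N (jz i j) = 0;
  cj_zeta_psi : forall i s, (n < i <= m)%N -> (n < s <= m)%N ->
    psi s 1%N (zeta i) = (i == s)%:R;
  cj_zeta_chain : forall i s t,
    (n < i <= m)%N -> (1 <= s <= n)%N -> (1 <= t <= p s)%N ->
    psi s t (zeta i) = 0 }.

Definition projP (u : E) : E :=
  \sum_(1 <= i < n.+1) \sum_(1 <= j < (p i).+1) jgamma i j u *: phi i j.

Definition projQ (y : F) : F :=
  \sum_(1 <= i < n.+1) \sum_(1 <= j < (p i).+1) psi i j y *: jz i j.

Definition projQ_mn (zeta : nat -> F) (y : F) : F :=
  \sum_(n.+1 <= i < m.+1) psi i 1%N y *: zeta i.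

(* Since R(B) is closed of codimension m, it is complementary to the span of
   the z_i^(1) and the [zeta i], so these conditions determine [Bp]. *)
Definition is_pseudoinverse (zeta : nat -> F) (Bp : {linear F -> E}) : Prop :=
  [/\ continuous Bp,
      forall i, (1 <= i <= n)%N -> Bp (jz i 1%N) = 0,
      forall i, (n < i <= m)%N -> Bp (zeta i) = 0 &
      forall y, oprange B y ->
        [/\ dom B (Bp y), B (Bp y) = y &
            forall i, (1 <= i <= n)%N -> jgamma i 1%N (Bp y) = 0]].

End Jordan.

Definition commutes_with (R : realType) (E F : normedModType R)
    (P : E -> E) (Q : F -> F) (A : linop E F) : Prop :=
  forall u, dom A u -> dom A (P u) /\ A (P u) = Q (A u).

(** * The k-tuples of chain elements *)

(* The index set {(i, j) | 1 <= i <= n, 1 <= j <= p i} is enumerated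
   lexicographically by ['I_(jdim n p)]. *)
Definition jdim (n : nat) (p : nat -> nat) : nat := (\sum_(i < n) p i.+1)%N.

Definition jtuple (n : nat) (p : nat -> nat) (V : Type) (X : nat -> nat -> V)
    (a : 'I_(jdim n p)) : V :=
  X (tagnat.sig1 a).+1 (tagnat.sig2 a).+1.

Definition lincomb (R : realType) (V : lmodType R) (k : nat)
    (C : 'cV[R]_k) (X : 'I_k -> V) : V :=
  \sum_(a < k) C a 0 *: X a.

Definition pairing (R : realType) (V : Type) (k : nat)
    (y : V) (X : 'I_k -> V -> R^o) : 'cV[R]_k :=
  \col_(a < k) X a y.

(* T Phi = M Z *)
Definition tuple_matrix (R : realType) (E F : normedModType R) (k : nat)
    (T : linop E F) (Phi : 'I_k -> E) (Z : 'I_k -> F) (M : 'M[R]_k) : Prop :=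
  forall a, T (Phi a) = \sum_(b < k) M a b *: Z b.

(** * Partial differential operators *)

Definition partial (R : realType) (N : nat) (V : normedModType R) (i : 'I_N)
    (f : 'rV[R]_N -> V) : 'rV[R]_N -> V :=
  fun x => derive f x (delta_mx 0 i).

(* D^kappa; the order of the partial derivatives is immaterial on functions of
   class C^|kappa|. *)
Definition mderive (R : realType) (N : nat) (V : normedModType R)
    (kappa : 'I_N -> nat) (f : 'rV[R]_N -> V) : 'rV[R]_N -> V :=
  foldr (fun i g => iter (kappa i) (partial i) g) f (enum 'I_N).

(* f is of class C^r on the open set Omega; values outside Omega are
   irrelevant. *)
Fixpoint smooth (R : realType) (N : nat) (V : normedModType R) (r : nat)
    (Omega : set 'rV[R]_N) (f : 'rV[R]_N -> V) : Prop :=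
  (forall x, Omega x -> {for x, continuous f}) /\
  if r is r'.+1 then
    forall i : 'I_N,
      (forall x, Omega x -> derivable f x (delta_mx 0 i)) /\
      smooth r' Omega (partial i f)
  else True.

(* L = \sum_(|kappa| <= pdo_order L) pdo_coef L kappa * D^kappa *)
Record pdo (R : realType) (N : nat) := Pdo {
  pdo_order : nat;
  pdo_coef : ('I_N -> nat) -> 'rV[R]_N -> R^o }.

Definition pdo_on (R : realType) (N : nat) (s : nat) (Omega : set 'rV[R]_N)
    (L : pdo R N) : Prop :=
  (forall kappa, (\sum_(i < N) kappa i <= pdo_order L)%N ->
     smooth s Omega (pdo_coef L kappa)) /\
  (exists2 kappa, (\sum_(i < N) kappa i = pdo_order L)%N &
     exists2 x, Omega x & pdo_coef L kappa x != 0).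

Definition pdo_apply (R : realType) (N : nat) (V : normedModType R)
    (L : pdo R N) (f : 'rV[R]_N -> V) (x : 'rV[R]_N) : V :=
  \sum_(kappa : {ffun 'I_N -> 'I_(pdo_order L).+1}
         | (\sum_(i < N) kappa i <= pdo_order L)%N)
    pdo_coef L (fun i => kappa i) x *: mderive (fun i => kappa i) f x.

(* u is a classical solution on Omega of
     L_0 (T u) + \sum_(1 <= i <= q) L_i (S_i u) = f.
   When [T] and the [S i] are closed and dom T is contained in every
   dom (S i), each [S i] is bounded in the graph norm of [T], so [S i \o u]
   inherits the smoothness of u and T u. *)
Definition classical_solution (R : realType) (N : nat) (E F : normedModType R)
    (r : nat) (Omega : set 'rV[R]_N) (q : nat) (L : nat -> pdo R N)
    (T : linop E F) (S : nat -> linop E F) (f : 'rV[R]_N -> F)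
    (u : 'rV[R]_N -> E) : Prop :=
  [/\ forall x, Omega x ->
        dom T (u x) /\ forall i, (1 <= i <= q)%N -> dom (S i) (u x),
      smooth r Omega u,
      smooth r Omega (T \o u) &
      forall x, Omega x ->
        pdo_apply (L 0%N) (T \o u) x +
        \sum_(1 <= i < q.+1) pdo_apply (L i) (S i \o u) x = f x].

(* Main.v *)
Require Import Defs.
From HB Require Import structures.
From mathcomp Require Import all_boot all_order all_algebra.
From mathcomp Require Import all_classical all_reals all_analysis.
From mathcomp Require Import lra zify.

Set Implicit Arguments.
Unset Strict Implicit.
Unset Printing Implicit Defensive.

Import Order.TTheory GRing.Theory Num.Theory.
Import numFieldNormedType.Exports.

Local Open Scope classical_set_scope.
Local Open Scope ring_scope.

(** The unknown is split along the projector [P = projP]: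
    [u = (u - P u) + P u].  The second summand is [(C, Phi)], where [C] consists
    of the coordinates [<u, gamma>].  The first summand is determined by
    [v := B u - Q (B u) = B (u - P u)]: it lies in the domain of [B], has image
    [v], and is annihilated by the functionals gamma_i^(1), three properties
    that single out [Bp v] because the gamma_i^(1) separate the points of the
    kernel of [B].

    Reversing the order inside each Jordan chain shows that [B] and [A_1]
    intertwine [P] and [Q], as the other operators do by assumption.  Hence
    [A_i (Bp v) = A_i (u - P u) = (I - Q) (A_i u)], so that the equation for
    [v] is the image of the given equation under the bounded map [I - Q].
    Likewise [<A_i u, Psi> = <Q (A_i u), Psi> = <A_i (P u), Psi>] is the
    transpose of the matrix of [A_i] applied to [C], and the equation for [C]
    is the image of the given one under the bounded map [<., Psi>].

    What remains is analytic: bounded maps must be moved through the operators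
    [L_i], which requires [A_i u] to be as smooth as [u] and [B u].  Since
    [dom B] is complete for the graph norm of [B] and [A_i] is closed, the
    closed graph theorem bounds [A_i] by that norm
    ([closed_graph_relatively_bounded]); convergence of [w] and [B w] then
    forces convergence of [A_i w], and applied to difference quotients this
    gives derivatives of [A_i u] of every order available for [u] and [B u]
    ([smooth_relatively_bounded], [pdo_apply_relatively_bounded]).  A bounded
    linear map is the special case in which [B] is the identity.
    [classical_solution_push] combines these facts. *)

(** * Operators on their domains *)

Section LinopTheory.
Context (R : realType) (E F : normedModType R) (T : linop E F).

Lemma domD x y : dom T x -> dom T y -> dom T (x + y).
Proof. by move=> dx dy; have := dom_lin 1 dx dy; rewrite scale1r. Qed.

Lemma domZ a x : dom T x -> dom T (a *: x).
Proof. by move=> dx; have := dom_lin a dx (dom_zero T); rewrite addr0. Qed.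

Lemma domB x y : dom T x -> dom T y -> dom T (x - y).
Proof. by move=> dx dy; rewrite -scaleN1r; exact: domD dx (domZ _ dy). Qed.

Lemma opD x y : dom T x -> dom T y -> T (x + y) = T x + T y.
Proof. by move=> dx dy; have := op_lin 1 dx dy; rewrite !scale1r. Qed.

Lemma op0 : T 0 = 0.
Proof.
have := opD (dom_zero T) (dom_zero T); rewrite addr0 => /eqP.
by rewrite -subr_eq subrr eq_sym => /eqP.
Qed.

Lemma opZ a x : dom T x -> T (a *: x) = a *: T x.
Proof.
by move=> dx; have := op_lin a dx (dom_zero T); rewrite op0 !addr0.
Qed.

Lemma opB x y : dom T x -> dom T y -> T (x - y) = T x - T y.
Proof.
move=> dx dy; have dNy := domZ (-1) dy.
by rewrite -[- y]scaleN1r opD// opZ// scaleN1r.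
Qed.

Lemma dom_sum (I : eqType) (s : seq I) (P : pred I) (f : I -> E) :
  (forall i, i \in s -> P i -> dom T (f i)) -> dom T (\sum_(i <- s | P i) f i).
Proof.
move=> df; rewrite big_seq_cond; apply: (big_ind (dom T)).
- exact: dom_zero.
- exact: domD.
- by move=> i /andP[]; exact: df.
Qed.

Lemma op_sum (I : eqType) (s : seq I) (P : pred I) (f : I -> E) :
  (forall i, i \in s -> P i -> dom T (f i)) ->
  T (\sum_(i <- s | P i) f i) = \sum_(i <- s | P i) T (f i).
Proof.
elim: s => [|i s IH] df; first by rewrite !big_nil op0.
have df' j : j \in s -> P j -> dom T (f j).
  by move=> js; apply: df; rewrite in_cons js orbT.
rewrite !big_cons; case: ifP => Pi; last exact: IH.
rewrite opD ?IH//; first by apply: df; rewrite ?mem_head.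
exact: dom_sum.
Qed.

Lemma closed_op_cvg (u_ : nat -> E) x y : closed_op T ->
  (forall k, dom T (u_ k)) -> u_ @ \oo --> x -> (T \o u_) @ \oo --> y ->
  dom T x /\ T x = y.
Proof.
move=> cT du ux Ty.
have [] // := @closed_cvg _ _ \oo _ (fun k => (u_ k, T (u_ k))) _ cT _ (x, y).
- by apply: nearW => k; split; [exact: du|].
- exact: cvg_pair ux Ty.
Qed.

End LinopTheory.

(** * The closed graph theorem *)

Section NestedLimits.
Context (R : realType).

Lemma complete_nested_cvg (E : completeNormedModType R) (u_ : nat -> E)
    (rho : nat -> R) :
  (forall i j, (i <= j)%N -> `|u_ j - u_ i| <= rho i) -> rho @ \oo --> 0 ->
  cvgn u_.
Proof.
move=> urho rho0; apply: cauchy_cvg; apply: cauchy_exP => e e0.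
have [n _ nrho] : \forall n \near \oo, `|0 - rho n| < e by exact: cvgr_dist_lt.
exists (u_ n), n => // j nj; rewrite -ball_normE /ball_/= distrC.
apply: le_lt_trans (urho _ _ nj) _; apply: le_lt_trans (nrho n (leqnn n)).
by rewrite sub0r normrN ler_norm.
Qed.

Lemma cvg_half_power (c : R) : (fun n => c * 2^-1 ^+ n) @ \oo --> 0.
Proof.
by have := @cvg_geometric R c 2^-1; apply; rewrite gtr0_norm ?invf_lt1 ?ltr1n.
Qed.

End NestedLimits.

Section GraphNorm.
Context (R : realType) (E F : normedModType R) (B : linop E F).

Definition graph_norm (x : E) : R := `|x| + `|B x|.

Lemma graph_norm_ge0 x : 0 <= graph_norm x.
Proof. by rewrite addr_ge0. Qed.

Lemma graph_normD x y : dom B x -> dom B y ->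
  graph_norm (x + y) <= graph_norm x + graph_norm y.
Proof.
by move=> dx dy; rewrite /graph_norm opD// addrACA lerD// ler_normD.
Qed.

Lemma graph_normZ a x : dom B x -> graph_norm (a *: x) = `|a| * graph_norm x.
Proof. by move=> dx; rewrite /graph_norm opZ// !normrZ mulrDr. Qed.

Lemma graph_norm_distC x y : dom B x -> dom B y ->
  graph_norm (x - y) = graph_norm (y - x).
Proof. by move=> dx dy; rewrite /graph_norm !opB// distrC (distrC (B x)). Qed.

Lemma graph_norm0 : graph_norm 0 = 0.
Proof. by rewrite /graph_norm op0 !normr0 addr0. Qed.

End GraphNorm.

(** Boundedness of [A] on [dom B] with its graph norm, without making [dom B]
    a normed space of its own. *)
Definition relatively_bounded (R : realType) (E F G : normedModType R)
    (B : linop E F) (A : linop E G) : Prop :=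
  dom B `<=` dom A /\
  exists M, forall y, dom B y -> `|A y| <= M * graph_norm B y.

Section ClosedGraph.
Context (R : realType) (E F G : completeNormedModType R).
Variables (B : linop E F) (A : linop E G).
Hypothesis cB : closed_op B.

(** Completeness of [dom B] for the graph norm, in the form needed for nested
    balls: the limit stays in each of the closed balls. *)
Lemma graph_norm_nested_limit (u_ : nat -> E) (rho : nat -> R) :
  (forall i, dom B (u_ i)) ->
  (forall i j, (i <= j)%N -> graph_norm B (u_ j - u_ i) <= rho i) ->
  rho @ \oo --> 0 ->
  exists2 x, dom B x &
    u_ @ \oo --> x /\ forall i, graph_norm B (x - u_ i) <= rho i.
Proof.
move=> du urho rho0.
have cu : cvgn u_.
  apply: complete_nested_cvg rho0 => i j ij; apply: le_trans (urho _ _ ij).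
  by rewrite lerDl.
have cBu : cvgn (B \o u_).
  apply: complete_nested_cvg rho0 => i j ij; apply: le_trans (urho _ _ ij).
  by rewrite /graph_norm opB// lerDr.
have [dl Bl] := closed_op_cvg cB du cu cBu.
exists (limn u_) => //; split=> // i; rewrite /graph_norm opB// Bl.
have lu : (fun j => `|u_ j - u_ i| + `|B (u_ j) - B (u_ i)|) @ \oo -->
    `|limn u_ - u_ i| + `|limn (B \o u_) - B (u_ i)|.
  by apply: cvgD; apply: cvg_norm; apply: cvgB => //; exact: cvg_cst.
rewrite -(cvg_lim _ lu)//; apply: limr_le.
  by apply/cvg_ex; eexists; exact: lu.
by exists i => // j /= ij; have := urho _ _ ij; rewrite /graph_norm opB.
Qed.

(** A category argument inside [dom B]: the sets where [`|A z| <= k] exhaust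
    [dom B], hence one of them is dense in some ball for the graph norm.
    Otherwise nested balls could be chosen, the k-th one missing the k-th set,
    and their common point would belong to none of the sets. *)
Lemma baire_graph_level : exists k x r, [/\ dom B x, 0 < r &
  forall y, dom B y -> graph_norm B (y - x) <= r -> forall e, 0 < e ->
    exists z, [/\ dom B z, `|A z| <= k & graph_norm B (z - y) < e]].
Proof.
apply: contrapT => nlevel.
(* [step k s t]: the ball [t] has at most half the radius of [s], lies inside
   it, and misses the k-th set; a ball is encoded as (centre, radius). *)
pose step (k : nat) (s t : E * R) := [/\ dom B t.1, 0 < t.2, t.2 <= s.2 / 2,
  graph_norm B (t.1 - s.1) <= s.2 / 2 &
  forall z, dom B z -> graph_norm B (z - t.1) <= t.2 -> k%:R < `|A z|].
have nextP (ks : nat * (E * R)) : exists t,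
    dom B ks.2.1 -> 0 < ks.2.2 -> step ks.1 ks.2 t.
  case: ks => k [x r] /=; have [[dx r0]|nxr] := pselect (dom B x /\ 0 < r);
    last by exists (x, r) => dx r0; case: nxr.
  have r20 : 0 < r / 2 by rewrite divr_gt0.
  apply: contrapT => nt; apply: nlevel.
  exists k%:R, x, (r / 2); split=> // y dy yx e e0.
  apply: contrapT => nz; apply: nt.
  have e20 : 0 < e / 2 by rewrite divr_gt0.
  exists (y, Num.min (e / 2) (r / 2)) => _ _; split=> //=.
  - by rewrite lt_min e20.
  - by rewrite ge_min lexx orbT.
  move=> z dz zy; rewrite ltNge; apply/negP => Azk; apply: nz.
  exists z; split=> //; apply: le_lt_trans zy _.
  by rewrite gt_min ltr_pdivrMr// ltr_pMr// ltr1n.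
have [next {}nextP] := choice nextP.
pose st := fix st k := if k is k'.+1 then next (k', st k') else (0 : E, 1 : R).
have stP k : dom B (st k).1 /\ 0 < (st k).2.
  elim: k => [|k [dk rk]]; first by split; [exact: dom_zero|].
  by have [] := nextP (k, st k) dk rk.
have stS k : step k (st k) (st k.+1).
  by have [dk rk] := stP k; exact: nextP (k, st k) dk rk.
have st0 : (st 0).2 = 1 by [].
clearbody st.
have st_near i d :
    graph_norm B ((st (i + d)%N).1 - (st i).1) + (st (i + d)%N).2 <= (st i).2.
  elim: d => [|d IH].
    by rewrite addn0 subrr graph_norm0 add0r.
  rewrite addnS; have [d1 r1 r12 near1 _] := stS (i + d)%N.
  have [d0 _] := stP (i + d)%N; have [di _] := stP i.
  apply: le_trans IH.
  have := graph_normD (domB d1 d0) (domB d0 di); rewrite subrKA; lra.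
have st_small k : (st k).2 <= 2^-1 ^+ k.
  elim: k => [|k IH]; first by rewrite st0.
  have [_ _ + _ _] := stS k; rewrite exprS; lra.
have [|| x dx [_ xP]] := @graph_norm_nested_limit (fun k => (st k).1)
  (fun k => (st k).2) (fun k => (stP k).1) _ _; last first.
(* The common point [x] violates the condition imposed on any ball whose index
   exceeds [`|A x|]. *)
- have [_ _ _ _ /(_ x dx (xP _))] := stS (Num.truncn `|A x|).+1.
  by rewrite ltNge => /negP; apply; apply: ltW; exact: Num.Theory.truncnS_gt.
- apply: (squeeze_cvgr (f := cst 0) (h := fun k => 1 * 2^-1 ^+ k)).
  + by apply: nearW => k; rewrite mul1r st_small andbT ltW//; exact: (stP k).2.
  + exact: cvg_cst.
  + exact: cvg_half_power.
- move=> i j /subnKC <-; apply: le_trans (st_near i (j - i)%N).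
  by rewrite lerDl; apply: ltW; exact: (stP _).2.
Qed.

Hypothesis cA : closed_op A.
Hypothesis dBA : dom B `<=` dom A.

(** A level set that is dense in one ball is, by translation and scaling,
    dense enough everywhere: each [y] can be approximated to within half of its
    graph norm by some [z] whose image is bounded by a multiple of that norm. *)
Lemma graph_norm_halving : exists2 c, 0 <= c &
  forall y, dom B y -> exists z,
    [/\ dom B z, `|A z| <= c * graph_norm B y &
        graph_norm B (y - z) <= graph_norm B y / 2].
Proof.
have [k [x [r [dx r0 lev]]]] := baire_graph_level.
have k0 : 0 <= k.
  have [|z [_ Az _]] := lev x dx _ 1 ltr01.
    by rewrite subrr graph_norm0 ltW.
  exact: le_trans Az.
exists ((k + k) / r) => [|y dy]; first by rewrite divr_ge0 ?addr_ge0// ltW.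
have := graph_norm_ge0 B y; rewrite le_eqVlt => /orP[/eqP y0|y0].
  exists 0; rewrite subr0 op0 normr0 -y0 mulr0 mul0r; split=> //.
  exact: dom_zero.
(* [t *: y] has graph norm [r], so that [x + t *: y] is in the ball. *)
have t0 : 0 < r / graph_norm B y by rewrite divr_gt0.
set t := r / graph_norm B y in t0.
have dty : dom B (t *: y) by exact: domZ.
have gty : graph_norm B (t *: y) = r.
  by rewrite graph_normZ// gtr0_norm// divfK// gt_eqF.
have e0 : 0 < r / 4 by rewrite divr_gt0.
have [|z1 [dz1 Az1 z1P]] := lev (t *: y + x) (domD dty dx) _ _ e0.
  by rewrite addrK gty.
have [|z2 [dz2 Az2 z2P]] := lev x dx _ _ e0.
  by rewrite subrr graph_norm0 ltW.
have dz := domB dz1 dz2.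
exists (t^-1 *: (z1 - z2)); split; first exact: domZ.
  rewrite opZ; last exact: dBA.
  rewrite normrZ gtr0_norm ?invr_gt0// /t invf_div mulrC -mulrA (mulrC r^-1).
  rewrite ler_wpM2r//.
    by rewrite divr_ge0 ?ltW.
  by rewrite opB; [|exact: dBA..]; rewrite (le_trans (ler_normB _ _))// lerD.
have -> : y - t^-1 *: (z1 - z2) = t^-1 *: (t *: y - (z1 - z2)).
  by rewrite [RHS]scalerBr scalerA mulVf ?scale1r// gt_eqF.
rewrite graph_normZ; last exact: domB.
rewrite gtr0_norm ?invr_gt0// {1}/t invf_div mulrAC -mulrA.
rewrite ler_wpM2l ?(ltW y0)//.
rewrite ler_pdivrMr//.
have -> : t *: y - (z1 - z2) = (t *: y + x - z1) + (z2 - x).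
  by rewrite [RHS]addrAC [X in X - z1]addrACA subrr addr0 opprB addrA.
apply: le_trans (graph_normD (domB (domD dty dx) dz1) (domB dz2 dx)) _.
rewrite graph_norm_distC//; last exact: domD.
lra.
Qed.

(** The halving lemma is iterated from [y]: the remainders tend to 0 in graph
    norm while the images under [A] of what has been subtracted form a Cauchy
    sequence.  The closedness of [A] identifies the limit of these images with
    [A y]. *)
Theorem closed_graph_relatively_bounded : relatively_bounded B A.
Proof.
split=> //; have [c c0 half] := graph_norm_halving.
exists (c * 2) => y dy; set g := graph_norm B y.
have g0 : 0 <= g := graph_norm_ge0 B y.
have nextP w : exists z, dom B w -> [/\ dom B z, `|A z| <= c * graph_norm B w &
    graph_norm B (w - z) <= graph_norm B w / 2].
  by have [/half[z zP]|nw] := pselect (dom B w); [exists z|exists 0].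
have [next {}nextP] := choice nextP.
pose y_ k := iter k (fun w => w - next w) y.
have y_S k : y_ k.+1 = y_ k - next (y_ k) by [].
have y_P k : dom B (y_ k) /\ graph_norm B (y_ k) <= g * 2^-1 ^+ k.
  elim: k => [|k [dk gk]]; first by rewrite expr0 mulr1.
  have [dz _ gz] := nextP _ dk; split; first exact: domB.
  by apply: le_trans gz _; rewrite exprSr mulrA ler_wpM2r.
have d_ k : dom B (y - y_ k) by exact: domB dy (y_P k).1.
have cvy : (fun k => y - y_ k) @ \oo --> y.
  apply/cvgrPdist_le => e e0.
  near=> k; rewrite opprB addrCA subrr addr0.
  apply: (@le_trans _ _ (g * 2^-1 ^+ k)).
    by apply: le_trans (y_P k).2; rewrite lerDl.
  by near: k; exact: cvgr_le (@cvg_half_power R g) _ e0.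
have incr i d : `|A (y - y_ (i + d)%N) - A (y - y_ i)| <=
    c * 2 * g * (2^-1 ^+ i - 2^-1 ^+ (i + d)).
  elim: d => [|d IH]; first by rewrite addn0 !subrr normr0 mulr0.
  have [ddk gdk] := y_P (i + d)%N; have [dz Az _] := nextP _ ddk.
  have -> : y - y_ (i + d.+1)%N = y - y_ (i + d)%N + next (y_ (i + d)%N).
    by rewrite addnS y_S opprB addrA addrAC.
  rewrite opD; [|exact/dBA/d_|exact: dBA].
  rewrite addrAC; apply: le_trans (ler_normD _ _) _.
  apply: le_trans (lerD IH (le_trans Az (ler_wpM2l c0 gdk))) _.
  rewrite [2^-1 ^+ (i + d.+1)](_ : _ = 2^-1 * 2^-1 ^+ (i + d)) ?addnS ?exprS//.
  lra.
have incr_le i j : (i <= j)%N ->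
    `|A (y - y_ j) - A (y - y_ i)| <= c * 2 * g * 2^-1 ^+ i.
  move=> /subnKC <-; apply: le_trans (incr i (j - i)%N) _.
  by rewrite ler_wpM2l ?mulr_ge0// gerBl exprn_ge0 ?invr_ge0.
have cvA : cvgn (fun k => A (y - y_ k)).
  exact: complete_nested_cvg incr_le (cvg_half_power _).
have [_ ->] := closed_op_cvg cA (fun k => dBA (d_ k)) cvy cvA.
rewrite -(cvg_lim _ (cvg_norm cvA))//; apply: limr_le.
  by apply/cvg_ex; eexists; exact: cvg_norm cvA.
apply: nearW => k; have := incr_le 0 k (leq0n k).
by rewrite subrr op0 subr0 expr0 mulr1 -mulrA.
Unshelve. all: by end_near. Qed.

End ClosedGraph.

(** * Derivatives and relatively bounded operators *)

Section SmoothEq.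
Context (R : realType) (N : nat) (V : normedModType R).
Variables (Omega : set 'rV[R]_N) (oOmega : open Omega).

Lemma near_eq_open (f g : 'rV[R]_N -> V) x : {in Omega, f =1 g} -> Omega x ->
  \forall y \near x, f y = g y.
Proof.
move=> fg Ox; near=> y; apply: fg; rewrite inE; near: y.
exact: open_nbhs_nbhs.
Unshelve. all: by end_near. Qed.

Lemma partial_eq_on (f g : 'rV[R]_N -> V) i : {in Omega, f =1 g} ->
  {in Omega, partial i f =1 partial i g}.
Proof.
by move=> fg x; rewrite inE => Ox; apply: near_eq_derive; exact: near_eq_open.
Qed.

Lemma continuous_eq_on (f g : 'rV[R]_N -> V) : {in Omega, f =1 g} ->
  (forall x, Omega x -> {for x, continuous f}) ->
  forall x, Omega x -> {for x, continuous g}.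
Proof.
move=> fg cf x Ox; have fgx := near_eq_open fg Ox.
rewrite /prop_for /continuous_at -(nbhs_singleton fgx).
by apply: cvg_trans; [exact: near_eq_cvg fgx|exact: cf].
Qed.

Lemma smooth_eq_on r (f g : 'rV[R]_N -> V) : {in Omega, f =1 g} ->
  smooth r Omega f -> smooth r Omega g.
Proof.
elim: r f g => [|r IH] f g fg [cf sf].
  by split=> // x Ox; exact: continuous_eq_on fg cf x Ox.
split; first exact: continuous_eq_on fg cf.
move=> i; have [df sdf] := sf i; split.
  by move=> x Ox; apply: near_eq_derivable (df x Ox); exact: near_eq_open.
by apply: IH sdf; exact: partial_eq_on.
Qed.

Lemma smoothW r (f : 'rV[R]_N -> V) : smooth r.+1 Omega f -> smooth r Omega f.
Proof.
elim: r f => [|r IH] f [cf sf]; split=> // i.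
by have [df sdf] := sf i; split=> //; exact: IH.
Qed.

Lemma smooth_continuous r (f : 'rV[R]_N -> V) : smooth r Omega f ->
  forall x, Omega x -> {for x, continuous f}.
Proof. by case: r => [|r] []. Qed.

Lemma mderive_eq_on kappa (f g : 'rV[R]_N -> V) : {in Omega, f =1 g} ->
  {in Omega, mderive kappa f =1 mderive kappa g}.
Proof.
move=> fg; rewrite /mderive; elim: (enum _) => [|i l IH] //=.
by elim: (kappa i) => [|k IHk] //=; exact: partial_eq_on.
Qed.

Lemma pdo_apply_eq_on (L : pdo R N) (f g : 'rV[R]_N -> V) :
  {in Omega, f =1 g} -> {in Omega, pdo_apply L f =1 pdo_apply L g}.
Proof.
move=> fg x Ox; apply: eq_bigr => kappa _.
by rewrite (mderive_eq_on _ fg).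
Qed.

End SmoothEq.

Section RelativelyBounded.
Context (R : realType) (E F G : normedModType R).
Variables (B : linop E F) (A : linop E G).

Hypothesis bA : relatively_bounded B A.

(** Convergence of [w] and of [B w] is convergence for the graph norm, for
    which [A] is continuous. *)
Lemma relatively_bounded_cvg (T : Type) (H : set_system T) {FH : Filter H}
    (w : T -> E) (x : E) : dom B x -> (\forall t \near H, dom B (w t)) ->
  w @ H --> x -> (B \o w) @ H --> B x -> (A \o w) @ H --> A x.
Proof.
move=> dx dw wx Bwx; have [dBA [M AM]] := bA.
apply: cvg_zero.
have MN : (fun t => M * (`|w t - x| + `|B (w t) - B x|)) @ H --> 0.
  rewrite -(mulr0 M); apply: cvgMr; rewrite -(addr0 0); apply: cvgD.
    rewrite -(normr0 E) -(subrr x); apply: cvg_norm.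
    by apply: cvgB => //; exact: cvg_cst.
  rewrite -(normr0 F) -(subrr (B x)); apply: cvg_norm.
  by apply: cvgB => //; exact: cvg_cst.
apply/cvgr0Pnorm_le => e e0.
near=> t.
have dt : dom B (w t) by near: t.
rewrite (_ : (A \o w - cst (A x)) t = A (w t) - A x)// -opB; [|exact: dBA..].
apply: le_trans (AM _ (domB dt dx)) _.
rewrite /graph_norm opB//; near: t; exact: cvgr_le MN _ e0.
Unshelve. all: by end_near. Qed.

End RelativelyBounded.

Section Derivative.
Context (R : realType) (N : nat) (E F : normedModType R).
Variables (B : linop E F) (Omega : set 'rV[R]_N) (oOmega : open Omega).
Hypothesis cB : closed_op B.

Local Notation quotient u x v :=
  (fun h => h^-1 *: ((u \o shift x) (h *: v) - u x)).

Lemma near_shift_open (x v : 'rV[R]_N) : Omega x ->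
  \forall h \near (0 : R)^', Omega (shift x (h *: v)).
Proof.
move=> Ox; apply: nbhs_dnbhs.
have c0 : (fun h : R => shift x (h *: v)) @ (0 : R) --> shift x ((0 : R) *: v).
  by apply: cvgD; [apply: cvgZ; [exact: cvg_id|exact: cvg_cst]|exact: cvg_cst].
by apply: c0; rewrite scale0r /= add0r; exact: open_nbhs_nbhs.
Qed.

Lemma quotient_in_dom (u : 'rV[R]_N -> E) x v :
  (forall y, Omega y -> dom B (u y)) -> Omega x ->
  \forall h \near 0^', dom B (quotient u x v h) /\
    B (quotient u x v h) = quotient (B \o u) x v h.
Proof.
move=> du Ox; near=> h.
have dh : dom B (u (shift x (h *: v))).
  by apply: du; near: h; exact: near_shift_open.
split; first by apply: domZ; apply: domB => //; exact: du.
by rewrite opZ ?opB//; [exact: du|apply: domB => //; exact: du].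
Unshelve. all: by end_near. Qed.

(** The pair (difference quotient of [u], difference quotient of [B u])
    stays in the closed graph of [B]. *)
Lemma derive_closed_op (u : 'rV[R]_N -> E) x v :
  (forall y, Omega y -> dom B (u y)) -> Omega x ->
  derivable u x v -> derivable (B \o u) x v ->
  dom B ('D_v u x) /\ B ('D_v u x) = 'D_v (B \o u) x.
Proof.
move=> du Ox deru derBu.
have [] := @closed_cvg _ _ ((0 : R)^') _
  (fun h => (quotient u x v h, quotient (B \o u) x v h)) _ cB _
  ('D_v u x, 'D_v (B \o u) x).
- by apply: filterS (quotient_in_dom v du Ox) => h [? <-].
- exact: cvg_pair deru derBu.
by move=> /= ? <-.
Qed.

Lemma derive_relatively_bounded (G : normedModType R) (A : linop E G)
    (u : 'rV[R]_N -> E) x v :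
  relatively_bounded B A ->
  (forall y, Omega y -> dom B (u y)) -> Omega x ->
  derivable u x v -> derivable (B \o u) x v ->
  derivable (A \o u) x v /\ 'D_v (A \o u) x = A ('D_v u x).
Proof.
move=> bA du Ox deru derBu.
have [dx Bx] := derive_closed_op du Ox deru derBu.
have dq := quotient_in_dom v du Ox.
suff qA : quotient (A \o u) x v @ 0^' --> A ('D_v u x).
  by split; [apply/cvg_ex; eexists; exact: qA|exact: cvg_lim qA].
apply: (@cvg_trans _ ((A \o quotient u x v) @ 0^')); last first.
  apply: (relatively_bounded_cvg bA) => //.
  - by apply: filterS dq => h [].
  - apply: (@cvg_trans _ (quotient (B \o u) x v @ 0^')); last by rewrite Bx.
    by apply: near_eq_cvg; apply: filterS dq => h [].
apply: near_eq_cvg; near=> h.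
have dh : dom B (u (shift x (h *: v))).
  by apply: du; near: h; exact: near_shift_open.
have [dBA _] := bA.
have dAh := dBA _ dh; have dAx := dBA _ (du _ Ox).
by rewrite /= opZ ?opB//; exact: domB.
Unshelve. all: by end_near. Qed.

(** The class of functions that is stable under partial derivatives and on
    which the relatively bounded operators act: smoothness for the graph norm
    of [B]. *)
Definition smooth_in_dom (r : nat) (u : 'rV[R]_N -> E) : Prop :=
  [/\ forall y, Omega y -> dom B (u y), smooth r Omega u &
      smooth r Omega (B \o u)].

Lemma smooth_in_dom_partial r u i : smooth_in_dom r.+1 u ->
  smooth_in_dom r (partial i u) /\
  {in Omega, B \o partial i u =1 partial i (B \o u)}.
Proof.
move=> [du su sBu]; have [_ /(_ i)[deru sdu]] := su.
have [_ /(_ i)[derBu sdBu]] := sBu.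
have dBu x : Omega x -> _ := fun Ox =>
  derive_closed_op du Ox (deru x Ox) (derBu x Ox).
have Bpart : {in Omega, B \o partial i u =1 partial i (B \o u)}.
  by move=> x; rewrite inE => /dBu[].
split=> //; split=> //; first by move=> x /dBu[].
by apply: smooth_eq_on sdBu => // x Ox; rewrite Bpart.
Qed.

Lemma smooth_in_domW r u : smooth_in_dom r.+1 u -> smooth_in_dom r u.
Proof. by move=> [du su sBu]; split=> //; exact: smoothW. Qed.

Section Composition.
Context (G : normedModType R) (A : linop E G).
Hypothesis bA : relatively_bounded B A.

Lemma partial_relatively_bounded r u i : smooth_in_dom r.+1 u ->
  {in Omega, A \o partial i u =1 partial i (A \o u)}.
Proof.
move=> [du [_ /(_ i)[deru _]] [_ /(_ i)[derBu _]]] x; rewrite inE => Ox.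
have [_ /esym//] := derive_relatively_bounded bA du Ox (deru x Ox) (derBu x Ox).
Qed.

Lemma smooth_relatively_bounded r u : smooth_in_dom r u ->
  smooth r Omega (A \o u).
Proof.
elim: r u => [|r IH] u su; have [du [cu su'] [cBu sBu']] := su.
  split=> // x Ox; have dn : \forall y \near x, dom B (u y).
    by apply: filterS (du) _; exact: open_nbhs_nbhs.
  exact: (relatively_bounded_cvg bA (du x Ox) dn (cu x Ox) (cBu x Ox)).
split.
  exact: smooth_continuous (IH u (smooth_in_domW su)).
move=> i; split.
  move=> x Ox.
  have [deru derBu] := ((su' i).1 x Ox, (sBu' i).1 x Ox).
  by have [] := derive_relatively_bounded bA du Ox deru derBu.
apply: smooth_eq_on (partial_relatively_bounded i su) _ => //.
by apply: IH; exact: (smooth_in_dom_partial i su).1.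
Qed.

Lemma mderive_relatively_bounded r kappa u : smooth_in_dom r u ->
  (\sum_(i < N) kappa i <= r)%N ->
  (forall x, Omega x -> dom B (mderive kappa u x)) /\
  {in Omega, A \o mderive kappa u =1 mderive kappa (A \o u)}.
Proof.
move=> su /subnK; rewrite -big_enum /mderive => rE; rewrite -{}rE in su.
(* The induction on the variables that remain to be differentiated needs the
   order of smoothness that is left, not only membership in [dom B]. *)
suff [[]] : smooth_in_dom (r - \sum_(i <- enum 'I_N) kappa i)
    (mderive kappa u) /\
  {in Omega, A \o mderive kappa u =1 mderive kappa (A \o u)} by [].
rewrite /mderive; move: (r - _)%N su => n.
elim: (enum 'I_N) n => [|i l IH] n /=; first by rewrite big_nil addn0.
rewrite big_cons addnA => /IH[].
move: (foldr _ u l) (foldr _ (A \o u) l) => w Aw.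
elim: (kappa i) n => [|k IHk] n; first by rewrite addn0.
rewrite addnS -addSn => sw Aw_eq; have [si eqi] := IHk _ sw Aw_eq.
split; first exact: (smooth_in_dom_partial i si).1.
move=> x Ox /=; have /= -> := partial_relatively_bounded i si Ox.
exact: partial_eq_on eqi x Ox.
Qed.

Lemma pdo_apply_relatively_bounded r (L : pdo R N) u : smooth_in_dom r u ->
  (pdo_order L <= r)%N -> forall x, Omega x ->
  dom A (pdo_apply L u x) /\ A (pdo_apply L u x) = pdo_apply L (A \o u) x.
Proof.
move=> su Lr x Ox; have [dBA _] := bA.
have dk (kappa : {ffun 'I_N -> 'I_(pdo_order L).+1}) :
    (\sum_(i < N) kappa i <= pdo_order L)%N ->
    dom A (mderive (fun i => kappa i) u x) /\
    A (mderive (fun i => kappa i) u x) = mderive (fun i => kappa i) (A \o u) x.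
  move=> kL; have [d eA] := mderive_relatively_bounded su (leq_trans kL Lr).
  by split; [exact/dBA/d|rewrite -eA// inE].
split.
  by apply: dom_sum => kappa _ kL; apply: domZ; exact: (dk _ kL).1.
rewrite /pdo_apply op_sum; last first.
  by move=> kappa _ kL; apply: domZ; exact: (dk _ kL).1.
by apply: eq_bigr => kappa kL; have [d <-] := dk _ kL; rewrite opZ.
Qed.

End Composition.
End Derivative.

Section Push.
Context (R : realType) (N r : nat) (Omega : set 'rV[R]_N) (oOmega : open Omega).

Local Notation idop V := (total_op (idfun : {linear V -> V})).

Lemma closed_idop (V : normedModType R) : closed_op (idop V).
Proof.
move=> [x y] cl; split=> //=; apply: contrapT => nyx.
have yx0 : 0 < `|y - x| / 2 by rewrite divr_gt0// normr_gt0 subr_eq0; apply/eqP.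
have [|[a b] [[_ /= ->]]] := cl (ball (x, y) (`|y - x| / 2)).
  exact: nbhsx_ballx.
move=> [/=]; rewrite -!ball_normE /ball_/= => ax ay.
have := ler_normD (y - a) (a - x); rewrite subrKA (distrC a); lra.
Qed.

(** Bounded linear maps are the operators bounded relatively to the identity,
    so that the results on relatively bounded operators cover them. *)
Lemma linear_relatively_bounded (V W : normedModType R) (K : {linear V -> W}) :
  continuous K -> relatively_bounded (idop V) (total_op K).
Proof.
move=> cK; split=> //.
have /linear_boundedP : bounded_near K (nbhs 0).
  by apply: continuous_linear_bounded; exact: cK.
move=> /pinfty_ex_gt0[M M0 KM]; exists M => y _ /=.
by apply: le_trans (KM y) _; rewrite ler_pM2l// lerDl.
Qed.

Section LinearMap.
Context (V W : normedModType R) (K : {linear V -> W}).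
Hypothesis cK : continuous K.

Lemma smooth_linear (f : 'rV[R]_N -> V) :
  smooth r Omega f -> smooth r Omega (K \o f).
Proof.
move=> sf; have sd : smooth_in_dom (idop V) Omega r f by [].
have bK := linear_relatively_bounded cK.
exact: (smooth_relatively_bounded oOmega (@closed_idop V) bK sd).
Qed.

Lemma pdo_apply_linear (L : pdo R N) (f : 'rV[R]_N -> V) x :
  smooth r Omega f -> (pdo_order L <= r)%N -> Omega x ->
  K (pdo_apply L f x) = pdo_apply L (K \o f) x.
Proof.
move=> sf Lr Ox; have sd : smooth_in_dom (idop V) Omega r f by [].
have bK := linear_relatively_bounded cK.
by have [] := pdo_apply_relatively_bounded oOmega (@closed_idop V) bK sd Lr Ox.
Qed.

End LinearMap.

(** The image of an equation under a bounded map [K] of its right-hand side.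
    It produces an equation for any [w] for which the new operators take the
    values [K (T u)] and [K (S_i u)]; relative boundedness of the [S_i] makes
    the functions [S_i u] smooth, so that [K] passes through each [L_i]. *)
Lemma classical_solution_push (E F E' F' : normedModType R) (q : nat)
    (L : nat -> pdo R N) (T : linop E F) (S : nat -> linop E F)
    (T' : linop E' F') (S' : nat -> linop E' F') (f : 'rV[R]_N -> F)
    (u : 'rV[R]_N -> E) (w : 'rV[R]_N -> E') (K : {linear F -> F'}) :
  closed_op T -> continuous K ->
  (forall i, (1 <= i <= q)%N -> relatively_bounded T (S i)) ->
  (forall i, (i <= q)%N -> (pdo_order (L i) <= r)%N) ->
  classical_solution r Omega q L T S f u ->
  (forall x, Omega x -> dom T' (w x) /\
     forall i, (1 <= i <= q)%N -> dom (S' i) (w x)) ->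
  smooth r Omega w ->
  (forall x, Omega x -> T' (w x) = K (T (u x))) ->
  (forall i x, (1 <= i <= q)%N -> Omega x -> S' i (w x) = K (S i (u x))) ->
  classical_solution r Omega q L T' S' (fun x => K (f x)) w.
Proof.
move=> cT cK bS Lr [du su sTu equ] dw sw T'w S'w.
have sd : smooth_in_dom T Omega r u by split=> // x /du[].
have Tw : {in Omega, K \o (T \o u) =1 T' \o w}.
  by move=> x; rewrite inE => Ox /=; rewrite T'w.
split=> //; first exact: smooth_eq_on Tw (smooth_linear cK sTu).
move=> x Ox; have xO : x \in Omega by rewrite inE.
rewrite -equ// linearD; congr (_ + _).
  rewrite (pdo_apply_linear cK sTu)//; last exact: Lr.
  exact/esym/(pdo_apply_eq_on oOmega (L 0%N) Tw xO).
rewrite linear_sum !big_nat; apply: eq_bigr => i iq.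
have iq' : (1 <= i <= q)%N by [].
have sSu := smooth_relatively_bounded oOmega cT (bS i iq') sd.
rewrite (pdo_apply_linear cK sSu)//; last first.
  by apply: Lr; case/andP: iq'.
have Sw : {in Omega, K \o (S i \o u) =1 S' i \o w}.
  by move=> y; rewrite inE => Oy /=; rewrite S'w.
exact/esym/(pdo_apply_eq_on oOmega (L i) Sw xO).
Qed.

End Push.

(** * Functionals and bases *)

Section Adjoint.
Context (R : realType) (E F : normedModType R) (T : linop E F).

Lemma adjoint_domP psi : adjoint_dom T psi ->
  dual (adjoint T psi) /\ forall u, dom T u -> psi (T u) = adjoint T psi u.
Proof. by move=> [_ [g Tg]]; have [] := xgetPex 0 (ex_intro _ g Tg). Qed.

End Adjoint.

Lemma is_basis_mem (R : realType) (V : lmodType R) (S : set V) d e i :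
  is_basis S d e -> (1 <= i <= d)%N -> S (e i).
Proof.
move=> [_ span] id; apply/span; exists (fun j => (j == i)%:R).
rewrite (bigD1_seq i) ?iota_uniq ?mem_index_iota//= eqxx scale1r big1 ?addr0//.
by move=> j /negPf ->; rewrite scale0r.
Qed.

Lemma dual_sum (R : realType) (V : normedModType R) (I : Type) (s : seq I)
    (g : V -> R^o) (c : I -> R) (e : I -> V) : dual g ->
  g (\sum_(i <- s) c i *: e i) = \sum_(i <- s) c i * g (e i).
Proof.
move=> [gl _]; have g0 : g 0 = 0.
  by have := gl (-1) 0 0; rewrite scaleN1r oppr0 addr0 scaleN1r addNr.
elim: s => [|i s IH]; first by rewrite !big_nil.
by rewrite !big_cons gl IH.
Qed.

Lemma biorthogonal_coord (R : realType) (V : normedModType R) (k : nat)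
    (g : V -> R^o) (c : 'I_k -> R) (e : 'I_k -> V) b :
  dual g -> (forall a, g (e a) = (a == b)%:R) ->
  g (\sum_(a < k) c a *: e a) = c b.
Proof.
move=> gD ge; rewrite (dual_sum _ _ _ gD) (bigD1 b)//= ge eqxx mulr1.
by rewrite big1 ?addr0// => a /negPf ab; rewrite ge ab mulr0.
Qed.

Section FiniteRank.
Context (R : realType) (V W : normedModType R) (k : nat).
Variables (f : 'I_k -> V -> R^o) (e : 'I_k -> W).
Hypothesis fD : forall a, dual (f a).

Lemma finite_rank_linear : linear (fun y => \sum_(a < k) f a y *: e a).
Proof.
move=> c x y; rewrite scaler_sumr -big_split/=; apply: eq_bigr => a _.
by have [fl _] := fD a; rewrite fl scalerDl scalerA.
Qed.

Lemma finite_rank_continuous : continuous (fun y => \sum_(a < k) f a y *: e a).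
Proof.
apply: continuous_big => [|a _ y]; first exact: add_continuous.
by apply: cvgZ; [exact: (fD a).2|exact: cvg_cst].
Qed.

End FiniteRank.

(** Exhibits the pairing as a map of finite rank, hence linear and continuous
    when the functionals are. *)
Lemma pairing_sum (R : realType) (V : Type) (k : nat) (y : V)
    (X : 'I_k -> V -> R^o) :
  pairing y X = \sum_(a < k) X a y *: (delta_mx a 0 : 'cV[R]_k).
Proof.
apply/colP => a; rewrite mxE summxE (bigD1 a)//= big1 ?addr0 => [|b ba].
  by rewrite !mxE !eqxx mulr1.
by rewrite !mxE eqxx andbT eq_sym (negPf ba) mulr0.
Qed.

(** * Complete Jordan sets *)

Lemma jtuple_sum (n : nat) (p : nat -> nat) (V : nmodType)
    (f : nat -> nat -> V) :
  \sum_(1 <= i < n.+1) \sum_(1 <= j < (p i).+1) f i j =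
  \sum_(a < jdim n p) jtuple f a.
Proof.
rewrite big_add1 big_mkord /=.
under eq_bigr do rewrite big_add1 big_mkord /=.
rewrite sig_big_dep /= (reindex _ (@tagnat.sig_bij_on n (fun i => p i.+1))).
by apply: eq_bigr.
Qed.

Lemma jtuple_index (n : nat) (p : nat -> nat) i j :
  (1 <= i <= n)%N -> (1 <= j <= p i)%N ->
  exists a : 'I_(jdim n p), forall (V : Type) (X : nat -> nat -> V),
    jtuple X a = X i j.
Proof.
case: i => // i iP; case: j => // j jP.
pose i' : 'I_n := Ordinal iP; pose j' : 'I_(p i'.+1) := Ordinal jP.
exists (@tagnat.rank n (fun i => p i.+1)
  (Tagged (fun i : 'I_n => 'I_(p i.+1)) j')).
by move=> V X; rewrite /jtuple /tagnat.sig2 /tagnat.sig1 tagnat.rankK.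
Qed.

Lemma eq_jtuple_index (n : nat) (p : nat -> nat) (a b : 'I_(jdim n p)) :
  (((tagnat.sig1 a).+1 == (tagnat.sig1 b).+1) &&
   ((tagnat.sig2 a).+1 == (tagnat.sig2 b).+1))%N = (a == b).
Proof.
by rewrite !eqSS -tagnat.eq_Rank !tagnat.sig2K.
Qed.

Section JordanChains.
Context (R : realType) (E F : normedModType R).
Variables (B A1 : linop E F) (n m : nat) (p : nat -> nat).
Variables (phi : nat -> nat -> E) (psi : nat -> nat -> F -> R^o).
Variable zeta : nat -> F.
Hypothesis hJ : complete_jordan_sets B A1 n m p phi psi zeta.
Hypothesis dBA : dom B `<=` dom A1.

Local Notation gamma := (jgamma A1 p psi).
Local Notation z := (jz A1 p phi).
Local Notation P := (projP A1 n p phi psi).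
Local Notation Q := (projQ A1 n p phi psi).

Lemma psi_dual i j : (1 <= i <= n)%N -> (1 <= j <= p i)%N -> dual (psi i j).
Proof. by move=> iP jP; have [[]] := cj_adj_dom hJ iP jP. Qed.

Lemma rev_index_range i j : (1 <= j <= p i)%N -> (1 <= p i + 1 - j <= p i)%N.
Proof. lia. Qed.

Lemma gamma_dual i j : (1 <= i <= n)%N -> (1 <= j <= p i)%N -> dual (gamma i j).
Proof.
move=> iP jP; have [_] := cj_adj_dom hJ iP (rev_index_range jP).
by case/adjoint_domP.
Qed.

Lemma psi_A1 i j u : (1 <= i <= n)%N -> (1 <= j <= p i)%N -> dom A1 u ->
  psi i j (A1 u) = gamma i (p i + 1 - j) u.
Proof.
move=> iP jP du; have [_ /adjoint_domP[_ ->//]] := cj_adj_dom hJ iP jP.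
by rewrite /jgamma; congr (adjoint _ (psi _ _) _); lia.
Qed.

Lemma psi_kernel_B i u : (1 <= i <= m)%N -> dom B u -> psi i 1%N (B u) = 0.
Proof.
move=> iP du; have [] := is_basis_mem (cj_adj_basis hJ) iP.
by move=> /adjoint_domP[_ ->]// ->.
Qed.

Hypothesis hnm : (n <= m)%N.

(** The adjoint chain relation read on elements: [psi_i^(j) (B u)] is the
    pairing of [u] with A_1^* psi_i^(j-1), and the definition of gamma counts
    the chain backwards from its end. *)
Lemma psi_B i j u : (1 <= i <= n)%N -> (1 <= j <= p i)%N -> dom B u ->
  psi i j (B u) = if j == 1%N then 0 else gamma i (p i + 2 - j) u.
Proof.
move=> iP jP du; case: eqP => [->|j1]; first by apply: psi_kernel_B => //; lia.
have [/adjoint_domP[_ ->//] _] := cj_adj_dom hJ iP jP.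
have jE : j = j.-1.+1 by lia.
rewrite jE (cj_adj_chain hJ iP); last lia.
by rewrite /jgamma; congr (adjoint _ (psi _ _) _); lia.
Qed.

Lemma phi_dom_A1 i j : (1 <= i <= n)%N -> (1 <= j <= p i)%N -> dom A1 (phi i j).
Proof. by move=> iP jP; apply: dBA; exact: (cj_dom hJ). Qed.

Lemma B_phi i j : (1 <= i <= n)%N -> (1 <= j <= p i)%N ->
  B (phi i j) = if j == 1%N then 0 else z i (p i + 2 - j).
Proof.
move=> iP jP; case: eqP => [->|j1].
  by have [] := is_basis_mem (cj_basis hJ) iP.
have jE : j = j.-1.+1 by lia.
rewrite jE (cj_chain hJ iP); last lia.
by rewrite /jz; congr (A1 (phi _ _)); lia.
Qed.

(** For [i = s] the condition [j + t = p s + 2] is symmetric in the two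
    positions, which is why the matrix of [B] is symmetric. *)
Lemma psi_B_phi i j s t : (1 <= i <= n)%N -> (1 <= j <= p i)%N ->
  (1 <= s <= n)%N -> (1 <= t <= p s)%N ->
  psi s t (B (phi i j)) = ((i == s) && (j + t == p s + 2)%N)%:R.
Proof.
move=> iP jP sP tP; rewrite psi_B//; last exact: (cj_dom hJ).
case: (t =P 1%N) => t1.
  by case: (i =P s) => //= ?; subst s; case: eqP => //; lia.
rewrite (cj_biorth_gamma hJ)//; last lia.
by case: (i =P s) => //= ?; subst s; congr (_ %:R); lia.
Qed.

Lemma dom_B_projP u : dom B (P u).
Proof.
rewrite /projP; apply: dom_sum => i; rewrite mem_index_iota => iP _.
apply: dom_sum => j; rewrite mem_index_iota => jP _.
by apply: domZ; exact: (cj_dom hJ).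
Qed.

(** Both sides, restricted to one chain, consist of the terms
    gamma_i^(j) (u) A_1 phi_i^(j-1) with j > 1, listed in opposite orders. *)
Lemma B_commutes : commutes_with P Q B.
Proof.
move=> u du; split; first exact: dom_B_projP.
rewrite /projP /projQ op_sum; last first.
  move=> i; rewrite mem_index_iota => iP _.
  apply: dom_sum => j; rewrite mem_index_iota => jP _.
  by apply: domZ; exact: (cj_dom hJ).
apply: eq_big_nat => i iP; rewrite op_sum; last first.
  move=> j; rewrite mem_index_iota => jP _.
  by apply: domZ; exact: (cj_dom hJ).
have pi0 : (0 < p i)%N by exact: (cj_length hJ).
(* The terms with index 1 vanish: phi_i is in the kernel of B and psi_i in that
   of its adjoint. *)
rewrite big_nat_recl// [RHS]big_nat_recl//.
rewrite opZ ?B_phi ?psi_B//; [|lia..|exact: (cj_dom hJ)].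
rewrite eqxx scaler0 scale0r !add0r.
rewrite [RHS]big_nat_rev/=; apply: eq_big_nat => j jP.
have jP' : (1 <= j.+1 <= p i)%N by lia.
have jP2 : (1 <= (1 + p i - j.+1).+1 <= p i)%N by lia.
rewrite opZ ?B_phi ?psi_B//; [|exact: (cj_dom hJ)].
rewrite !ifF; [|lia..].
by congr (gamma _ _ _ *: z _ _); lia.
Qed.

(** The same reversal of each chain, now without a boundary term. *)
Lemma A1_commutes u : dom A1 u -> dom A1 (P u) /\ A1 (P u) = Q (A1 u).
Proof.
move=> du; split; first exact/dBA/dom_B_projP.
rewrite /projP /projQ op_sum; last first.
  move=> i; rewrite mem_index_iota => iP _.
  apply: dom_sum => j; rewrite mem_index_iota => jP _.
  by apply: domZ; exact: phi_dom_A1.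
apply: eq_big_nat => i iP; rewrite op_sum; last first.
  move=> j; rewrite mem_index_iota => jP _.
  by apply: domZ; exact: phi_dom_A1.
rewrite [RHS]big_nat_rev/=; apply: eq_big_nat => j jP.
have jP' : (1 <= 1 + (p i).+1 - j.+1 <= p i)%N by lia.
rewrite opZ ?psi_A1//; last exact: phi_dom_A1.
rewrite /jz; congr (gamma _ _ _ *: A1 (phi _ _)); lia.
Qed.

Lemma projPE u : P u = \sum_(a < jdim n p) jtuple gamma a u *: jtuple phi a.
Proof. exact: (jtuple_sum n p (fun i j => gamma i j u *: phi i j)). Qed.

Lemma projQE y : Q y = \sum_(a < jdim n p) jtuple psi a y *: jtuple z a.
Proof. exact: (jtuple_sum n p (fun i j => psi i j y *: z i j)). Qed.

Lemma jtuple_psi_dual (a : 'I_(jdim n p)) : dual (jtuple psi a).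
Proof. apply: psi_dual; exact: ltn_ord. Qed.

Lemma jtuple_gamma_dual (a : 'I_(jdim n p)) : dual (jtuple gamma a).
Proof. apply: gamma_dual; exact: ltn_ord. Qed.

Lemma jtuple_phi_dom_B (a : 'I_(jdim n p)) : dom B (jtuple phi a).
Proof. apply: (cj_dom hJ); exact: ltn_ord. Qed.

Lemma jtuple_psi_z (a b : 'I_(jdim n p)) :
  jtuple psi b (jtuple z a) = (a == b)%:R.
Proof.
rewrite /jtuple (cj_biorth_z hJ); [|exact: ltn_ord..].
by rewrite eq_jtuple_index.
Qed.

Lemma jtuple_gamma_phi (a b : 'I_(jdim n p)) :
  jtuple gamma b (jtuple phi a) = (a == b)%:R.
Proof.
rewrite /jtuple (cj_biorth_gamma hJ); [|exact: ltn_ord..].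
by rewrite eq_jtuple_index.
Qed.

Lemma psi_B_phi_sym (a b : 'I_(jdim n p)) :
  jtuple psi b (B (jtuple phi a)) = jtuple psi a (B (jtuple phi b)).
Proof.
rewrite /jtuple !psi_B_phi; [|exact: ltn_ord..].
move: (tagnat.sig2 a) (tagnat.sig2 b).
move: (tagnat.sig1 a) (tagnat.sig1 b) => i s.
have [->|/negPf nis] := eqVneq i s => j t.
  by rewrite !eqxx/= [(j.+1 + _)%N]addnC.
by rewrite !eqSS !val_eqE [s == i]eq_sym nis.
Qed.

Lemma psi_projQ (b : 'I_(jdim n p)) y : jtuple psi b (Q y) = jtuple psi b y.
Proof.
rewrite projQE (biorthogonal_coord _ (b := b))//; first exact: jtuple_psi_dual.
by move=> a; exact: jtuple_psi_z.
Qed.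

Lemma gamma_projP (b : 'I_(jdim n p)) u :
  jtuple gamma b (P u) = jtuple gamma b u.
Proof.
rewrite projPE (biorthogonal_coord _ (b := b))//.
  exact: jtuple_gamma_dual.
by move=> a; exact: jtuple_gamma_phi.
Qed.

(** On the kernel of [B] the gamma_i^(1) are the coordinate functionals of the
    basis phi_i. *)
Lemma kernel_gamma_eq0 w : dom B w -> B w = 0 ->
  (forall i, (1 <= i <= n)%N -> gamma i 1%N w = 0) -> w = 0.
Proof.
move=> dw Bw gw; have [_ span] := cj_basis hJ.
have [c wE] : exists c : nat -> R, w = \sum_(1 <= i < n.+1) c i *: phi i 1%N.
  by apply/span; split.
have c0 s : (1 <= s <= n)%N -> c s = 0.
  move=> sn; have ps := cj_length hJ sn.
  have gd : dual (gamma s 1%N) by apply: gamma_dual => //; lia.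
  have := gw s sn; rewrite wE (dual_sum _ _ _ gd).
  rewrite (bigD1_seq s) ?iota_uniq ?mem_index_iota//=.
  rewrite (cj_biorth_gamma hJ) ?eqxx ?ps// mulr1.
  rewrite big_seq_cond big1 ?addr0// => i /andP[].
  rewrite mem_index_iota => iP /negPf si.
  rewrite (cj_biorth_gamma hJ) ?si ?mulr0// ?ps//.
  by rewrite (cj_length hJ).
by rewrite wE big_nat big1// => i iP; rewrite c0// scale0r.
Qed.

(** [u - P u] has the three properties that determine [Bp] on the range of [B]:
    domain, image, and vanishing of the gamma_i^(1). *)
Lemma pseudoinverseK (Bp : {linear F -> E}) u :
  is_pseudoinverse B A1 n m p phi psi zeta Bp -> dom B u ->
  Bp (B u - Q (B u)) = u - P u.
Proof.
move=> [_ _ _ BpP] du; have [dPu BPu] := B_commutes du.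
have dw := domB du dPu.
have [] := BpP (B (u - P u)); first by exists (u - P u).
rewrite opB// BPu => dBp BBp gBp.
apply/eqP; rewrite -subr_eq0; apply/eqP/kernel_gamma_eq0.
- exact: domB.
- by rewrite opB// BBp opB// BPu subrr.
move=> i iP; have pi0 := cj_length hJ iP.
have i1 : (1 <= 1 <= p i)%N by lia.
have gd := gamma_dual iP i1.
have gB x y : gamma i 1%N (x - y) = gamma i 1%N x - gamma i 1%N y.
  have [gl _] := gd.
  by rewrite -scaleN1r addrC gl scaleN1r addrC.
have [a aE] := jtuple_index iP i1.
have gP := gamma_projP a u; rewrite !aE in gP.
by rewrite !gB gBp// gP !subrr.
Qed.

Lemma tuple_matrixE (T : linop E F) (M : 'M[R]_(jdim n p)) a b :
  tuple_matrix T (jtuple phi) (jtuple z) M ->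
  jtuple psi b (T (jtuple phi a)) = M a b.
Proof.
move=> TM; rewrite TM (biorthogonal_coord _ (b := b))//.
  exact: jtuple_psi_dual.
by move=> c; exact: jtuple_psi_z.
Qed.

(** [<T u, Psi>] depends only on the [P]-part of [u], because [T] intertwines
    [P] and [Q] and [Psi] does not see [I - Q]. *)
Lemma matrix_pairing (T : linop E F) (M : 'M[R]_(jdim n p)) u :
  dom B `<=` dom T -> commutes_with P Q T ->
  tuple_matrix T (jtuple phi) (jtuple z) M -> dom T u ->
  M^T *m pairing u (jtuple gamma) = pairing (T u) (jtuple psi).
Proof.
move=> dBT cT TM du; apply/colP => b; rewrite !mxE -psi_projQ.
have [_ <-] := cT u du.
have dphi (a : 'I_(jdim n p)) : dom T (jtuple phi a).
  exact/dBT/jtuple_phi_dom_B.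
rewrite projPE op_sum => [|a _ _]; last exact/domZ/dphi.
under [X in jtuple psi b X]eq_bigr do rewrite opZ//.
rewrite (dual_sum _ _ _ (jtuple_psi_dual b)); apply: eq_bigr => a _.
by rewrite !mxE mulrC (tuple_matrixE _ _ TM).
Qed.

Lemma matrix_B_sym (M : 'M[R]_(jdim n p)) :
  tuple_matrix B (jtuple phi) (jtuple z) M -> M^T = M.
Proof.
move=> BM; apply/matrixP => a b.
by rewrite mxE -!(tuple_matrixE _ _ BM) psi_B_phi_sym.
Qed.

End JordanChains.

(** * The decomposition *)

Theorem theorem2 (R : realType) (E1 E2 : completeNormedModType R)
  (* operators B, A_1, ..., A_q *)
  (q n m : nat) (B : linop E1 E2) (A : nat -> linop E1 E2)
  (hq : (0 < q)%N)
  (hnm : (n < m)%N)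
  (hBclosed : closed_op B) (hBdense : dense (dom B))
  (hAclosed : forall i, (1 <= i <= q)%N -> closed_op (A i))
  (hAdense : forall i, (1 <= i <= q)%N -> dense (dom (A i)))
  (hBA : forall i, (1 <= i <= q)%N -> dom B `<=` dom (A i))
  (hB : noetherian B n m)
  (* Condition 1 *)
  (p : nat -> nat) (phi : nat -> nat -> E1) (psi : nat -> nat -> E2 -> R^o)
  (zeta : nat -> E2)
  (hJ : complete_jordan_sets B (A 1%N) n m p phi psi zeta)
  (* Condition 2 *)
  (hcomm : forall i, (2 <= i <= q)%N ->
     commutes_with (projP (A 1%N) n p phi psi) (projQ (A 1%N) n p phi psi) (A i))
  (* pseudoinverse of B *)
  (Bp : {linear E2 -> E1})
  (hBp : is_pseudoinverse B (A 1%N) n m p phi psi zeta Bp)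
  (* matrices of A_1, ..., A_q and B *)
  (cA : nat -> 'M[R]_(jdim n p)) (cB : 'M[R]_(jdim n p))
  (hcA : forall i, (1 <= i <= q)%N ->
     tuple_matrix (A i) (jtuple phi) (jtuple (jz (A 1%N) p phi)) (cA i))
  (hcB : tuple_matrix B (jtuple phi) (jtuple (jz (A 1%N) p phi)) cB)
  (* differential operators L_0, ..., L_q and data, of class C^s; solutions of
     class C^r *)
  (N r s : nat) (Omega : set 'rV[R]_N) (hOmega : open Omega)
  (L : nat -> pdo R N)
  (hL : forall i, (i <= q)%N -> pdo_on s Omega (L i))
  (horder : forall i j, (i < j <= q)%N -> (pdo_order (L j) < pdo_order (L i))%N)
  (hr : (pdo_order (L 0%N) <= r)%N)
  (f : 'rV[R]_N -> E2) (hf : smooth s Omega f)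
  (u : 'rV[R]_N -> E1)
  (hu : classical_solution r Omega q L B A f u) :
  exists (v : 'rV[R]_N -> E2) (C : 'rV[R]_N -> 'cV[R]_(jdim n p)),
    [/\ forall x, Omega x -> u x = Bp (v x) + lincomb (C x) (jtuple phi),
        forall x, Omega x ->
          range (fun y => y - projQ (A 1%N) n p phi psi y) (v x) /\
          range (fun y => y - projQ_mn n m psi zeta y) (v x),
        classical_solution r Omega q L
          (total_op idfun) (fun i => comp_op (A i) Bp)
          (fun x => f x - projQ (A 1%N) n p phi psi (f x)) v &
        classical_solution r Omega q L
          (total_op (mulmx cB)) (fun i => total_op (mulmx (cA i)^T))
          (fun x => pairing (f x) (jtuple psi)) C].
Proof.
have dBA1 : dom B `<=` dom (A 1%N) by apply: hBA; rewrite hq.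
have leqnm := ltnW hnm.
set P := projP (A 1%N) n p phi psi in hcomm *.
set Q := projQ (A 1%N) n p phi psi in hcomm *.
have cmB : commutes_with P Q B := B_commutes hJ leqnm.
have cmA i : (1 <= i <= q)%N -> commutes_with P Q (A i).
  by case: i => [|[|i]]// iq; [move=> w; exact: (A1_commutes hJ)|exact: hcomm].
have bA i : (1 <= i <= q)%N -> relatively_bounded B (A i).
  move=> iq; apply: closed_graph_relatively_bounded => //.
  - exact: hAclosed.
  - exact: hBA.
have Lr i : (i <= q)%N -> (pdo_order (L i) <= r)%N.
  case: i => // i iq; apply: leq_trans hr; apply: ltnW.
  by apply: horder; rewrite iq.
have psiD := jtuple_psi_dual hJ; have gammaD := jtuple_gamma_dual hJ.
have [dBu su sBu _] := hu.
have QE : Q = fun y => \sum_(a < jdim n p)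
    jtuple psi a y *: jtuple (jz (A 1%N) p phi) a.
  by apply/funext => y; exact: projQE.
have lQ : linear (fun y => y - Q y).
  rewrite QE => c x y; rewrite finite_rank_linear//.
  by rewrite scalerBr opprD addrACA.
have cQ : continuous (fun y => y - Q y).
  rewrite QE => y; apply: cvgB; first exact: cvg_id.
  by apply: finite_rank_continuous.
have pairingE (V : normedModType R) (X : 'I_(jdim n p) -> V -> R^o) :
    (fun y => pairing y X) =
    fun y => \sum_(a < jdim n p) X a y *: (delta_mx a 0 : 'cV[R]_(jdim n p)).
  by apply/funext => y; exact: pairing_sum.
have lpair (V : normedModType R) (X : 'I_(jdim n p) -> V -> R^o) :
    (forall a, dual (X a)) -> linear (fun y => pairing y X).
  by move=> dX; rewrite pairingE; exact: finite_rank_linear.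
have cpair (V : normedModType R) (X : 'I_(jdim n p) -> V -> R^o) :
    (forall a, dual (X a)) -> continuous (fun y => pairing y X).
  by move=> dX; rewrite pairingE; exact: finite_rank_continuous.
(* The three bounded maps that carry the given equation to the one for [v] and
   to the one for [C], and [u] to [C]. *)
pose KQ : {linear E2 -> E2} :=
  HB.pack (fun y => y - Q y) (GRing.isLinear.Build _ _ _ _ _ lQ).
pose Kpsi : {linear E2 -> 'cV[R]_(jdim n p)} := HB.pack
  (fun y => pairing y (jtuple psi))
  (GRing.isLinear.Build _ _ _ _ _ (lpair _ _ psiD)).
pose Kgamma : {linear E1 -> 'cV[R]_(jdim n p)} := HB.pack
  (fun x => pairing x (jtuple (jgamma (A 1%N) p psi)))
  (GRing.isLinear.Build _ _ _ _ _ (lpair _ _ gammaD)).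
have Bpv x : Omega x -> Bp (KQ (B (u x))) = u x - P (u x).
  by move=> Ox; exact: (pseudoinverseK hJ leqnm hBp (dBu x Ox).1).
exists (fun x => KQ (B (u x))), (fun x => Kgamma (u x)); split.
- move=> x Ox; rewrite Bpv//.
  have -> : lincomb (Kgamma (u x)) (jtuple phi) = P (u x).
    by rewrite /P projPE; apply: eq_bigr => a _; rewrite mxE.
  by rewrite subrK.
- move=> x Ox; have [dux _] := dBu x Ox; split; first by exists (B (u x)).
  (* The functionals psi_i with i > n vanish on the range of [B], so that the
     second projector annihilates [v], which is its own preimage. *)
  exists (KQ (B (u x))) => //.
  rewrite /projQ_mn big_nat big1 ?subr0// => i /andP[ni im].
  have [dPu BPu] := cmB _ dux.
  rewrite [KQ _](_ : _ = B (u x - P (u x))); last by rewrite opB// BPu.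
  rewrite (psi_kernel_B hJ) ?scale0r//; last exact: domB.
  by rewrite (leq_trans _ ni).
- apply: (classical_solution_push (K := KQ) hOmega hBclosed cQ bA Lr hu) => //.
  + move=> x Ox; split=> // i iq.
    rewrite /= [dom _ _]/(dom (A i) (Bp (KQ (B (u x))))) Bpv//.
    have [dux _] := dBu x Ox; apply: hBA => //.
    by apply: domB => //; exact: (cmB _ dux).1.
  + exact: (smooth_linear hOmega (K := KQ) cQ sBu).
  + move=> i x iq Ox; rewrite /= -/(KQ (B (u x))) [in LHS]/= Bpv//.
    have [dux dAu] := dBu x Ox; have [dPu APu] := cmA i iq _ (dAu i iq).
    rewrite opB ?APu//; exact: dAu.
- apply: (classical_solution_push (K := Kpsi) hOmega hBclosed
    (cpair _ _ psiD) bA Lr hu) => //.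
  + exact: (smooth_linear hOmega (K := Kgamma) (cpair _ _ gammaD) su).
  + move=> x Ox /=; have [dux _] := dBu x Ox.
    rewrite -[cB](matrix_B_sym hJ leqnm hcB).
    exact: (matrix_pairing hJ _ cmB hcB dux).
  + move=> i x iq Ox /=; have [_ dAu] := dBu x Ox.
    exact: (matrix_pairing hJ (hBA i iq) (cmA i iq) (hcA i iq) (dAu i iq)).
Qed.
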